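(* Consider the two compact finite difference schemes (described in the context) for the two-dimensional two-sided space fractional diffusion problem with $1<\alpha,\beta\le2$. If $(p,q)=(1,0)$, both schemes are unconditionally stable for all $1<\alpha,\beta\le2$; if $(p,q)=(1,-1)$, both schemes are unconditionally stable for all $\frac{1+\sqrt{73}}{6}\le\alpha,\beta\le2$.
   Context: Problem on $\Omega=(a,b)\times(c,d)$, $t\in(0,T]$: $\partial_tu=K_1^+\,{}_aD_x^\alpha u+K_2^+\,{}_xD_b^\alpha u+K_1^-\,{}_cD_y^\beta u+K_2^-\,{}_yD_d^\beta u+f$, $u(\cdot,\cdot,0)=u_0$, $u=\varphi$ on $\partial\Omega$, with constants $K_i^\pm\ge0$, $(K_1^+)^2+(K_2^+)^2\ne0$, $(K_1^-)^2+(K_2^-)^2\ne0$; ${}_aD_x^\alpha,{}_xD_b^\alpha$ (resp. ${}_cD_y^\beta,{}_yD_d^\beta$) are the left and right Riemann–Liouville derivatives in $x$ on $(a,b)$ (resp. in $y$ on $(c,d)$). Grid: common step $h$ with $b-a=N_xh$, $d-c=N_yh$, $\tau=T/M$, $x_i=a+ih$, $y_j=c+jh$, $t_n=n\tau$. For $\gamma\in\{\alpha,\beta\}$ let $g_k^{(\gamma)}=(-1)^k\binom{\gamma}{k}$ and define weights $w_k^{(\gamma)}$: for $(p,q)=(1,0)$, $w_0^{(\gamma)}=\frac{\gamma}{2}g_0^{(\gamma)}$, $w_k^{(\gamma)}=\frac{\gamma}{2}g_k^{(\gamma)}+\frac{2-\gamma}{2}g_{k-1}^{(\gamma)}$ ($k\ge1$);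 for $(p,q)=(1,-1)$, $w_0^{(\gamma)}=\frac{2+\gamma}{4}g_0^{(\gamma)}$, $w_1^{(\gamma)}=\frac{2+\gamma}{4}g_1^{(\gamma)}$, $w_k^{(\gamma)}=\frac{2+\gamma}{4}g_k^{(\gamma)}+\frac{2-\gamma}{4}g_{k-2}^{(\gamma)}$ ($k\ge2$). Let $c^\gamma=\frac{7\gamma-3\gamma^2}{24}$ for $(p,q)=(1,0)$ and $c^\gamma=\frac{\gamma-3\gamma^2+12}{24}$ for $(p,q)=(1,-1)$. Operators on grid functions: $\mathcal{C}_xV_{i,j}=V_{i,j}+c^\alpha(V_{i-1,j}-2V_{i,j}+V_{i+1,j})$, $\mathcal{C}_yV_{i,j}=V_{i,j}+c^\beta(V_{i,j-1}-2V_{i,j}+V_{i,j+1})$, $\delta_x^\alpha V_{i,j}=\frac{K_1^+}{h^\alpha}\sum_{k=0}^{i+1}w_k^{(\alpha)}V_{i-k+1,j}+\frac{K_2^+}{h^\alpha}\sum_{k=0}^{N_x-i+1}w_k^{(\alpha)}V_{i+k-1,j}$, $\delta_y^\beta V_{i,j}=\frac{K_1^-}{h^\beta}\sum_{k=0}^{j+1}w_k^{(\beta)}V_{i,j-k+1}+\frac{K_2^-}{h^\beta}\sum_{k=0}^{N_y-j+1}w_k^{(\beta)}V_{i,j+k-1}$. Scheme I: $(\mathcal{C}_x-\frac{\tau}{2}\delta_x^\alpha)(\mathcal{C}_y-\frac{\tau}{2}\delta_y^\beta)U^{n+1}_{i,j}=(\mathcal{C}_x+\frac{\tau}{2}\delta_x^\alpha)(\mathcal{C}_y+\frac{\tau}{2}\delta_y^\beta)U^n_{i,j}+\tau\mathcal{C}_x\mathcal{C}_yf^{n+1/2}_{i,j}$;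 Scheme II: the same with the additional source term $\frac{\tau^3}{4}\delta_x^\alpha\delta_y^\beta f^{n+1/2}_{i,j}$ on the right; here $1\le i\le N_x-1$, $1\le j\le N_y-1$, $f^{n+1/2}_{i,j}=f(x_i,y_j,t_n+\tau/2)$, with boundary values from $\varphi$. For $m\in\{N_x,N_y\}$ and $\gamma\in\{\alpha,\beta\}$ let $A_\gamma$ be the $(m-1)\times(m-1)$ matrix with entries $w^{(\gamma)}_{i-j+1}$ when $i-j+1\ge0$ and $0$ otherwise, and $C_\gamma=I+c^\gamma\,\mathrm{tridiag}(1,-2,1)$ (with $m=N_x$ for $\alpha$, $m=N_y$ for $\beta$). Ordering the interior unknowns with $i$ running fastest, set $\mathcal{C}_x=I_y\otimes C_\alpha$, $\mathcal{C}_y=C_\beta\otimes I_x$, $\mathcal{D}_x=\frac{\tau}{2h^\alpha}I_y\otimes(K_1^+A_\alpha+K_2^+A_\alpha^T)$, $\mathcal{D}_y=\frac{\tau}{2h^\beta}(K_1^-A_\beta+K_2^-A_\beta^T)\otimes I_x$, where $I_x,I_y$ are identities of orders $N_x-1,N_y-1$. Perturbations of the interior solution propagate (for both schemes) as $\delta U^{n+1}=G\,\delta U^n$ with $G=(\mathcal{C}_y-\mathcal{D}_y)^{-1}(\mathcal{C}_x-\mathcal{D}_x)^{-1}(\mathcal{C}_x+\mathcal{D}_x)(\mathcal{C}_y+\mathcal{D}_y)$. Unconditionally stable means: for all $\tau,h>0$ the inverted matrices exist and $G^n\to0$ as $n\to\infty$. *)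

(* Defs.v *)
From HB Require Import structures.
From mathcomp Require Import all_boot all_order all_algebra.
From mathcomp Require Import all_classical all_reals all_analysis.
Set Implicit Arguments. Unset Strict Implicit. Unset Printing Implicit Defensive.
Import Order.TTheory GRing.Theory Num.Theory.
Import numFieldNormedType.Exports.
Local Open Scope ring_scope.
Local Open Scope classical_set_scope.

Inductive pq_choice := PQ10 (* (p,q) = (1,0) *) | PQ1m1 (* (p,q) = (1,-1) *).

Section Scheme.
Variable R : realType.

Definition gbinom (gamma : R) (k : nat) : R :=
  (\prod_(i < k) (gamma - i%:R)) / (k`!)%:R.

Definition gcoef (gamma : R) (k : nat) : R := (-1) ^+ k * gbinom gamma k.

Definition wcoef (pq : pq_choice) (gamma : R) (k : nat) : R :=
  match pq with
  | PQ10 =>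
      if k is k'.+1 then gamma / 2 * gcoef gamma k + (2 - gamma) / 2 * gcoef gamma k'
      else gamma / 2 * gcoef gamma 0
  | PQ1m1 =>
      match k with
      | 0%N | 1%N => (2 + gamma) / 4 * gcoef gamma k
      | k'.+2 => (2 + gamma) / 4 * gcoef gamma k + (2 - gamma) / 4 * gcoef gamma k'
      end
  end.

Definition ccoef (pq : pq_choice) (gamma : R) : R :=
  match pq with
  | PQ10 => (7 * gamma - 3 * gamma ^+ 2) / 24
  | PQ1m1 => (gamma - 3 * gamma ^+ 2 + 12) / 24
  end.

Definition Amat (pq : pq_choice) (gamma : R) (m : nat) : 'M[R]_(m.-1) :=
  \matrix_(i, j) (if (j <= i.+1)%N then wcoef pq gamma (i.+1 - j) else 0).

Definition Cmat (pq : pq_choice) (gamma : R) (m : nat) : 'M[R]_(m.-1) :=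
  \matrix_(i, j)
    ((i == j)%:R
     + ccoef pq gamma * (if i == j then -2
                         else if ((i.+1 == j) || (j.+1 == i))%N then 1 else 0)).

Definition mxn (p : nat) (A : 'M[R]_p) (i j : nat) : R :=
  match @insub _ (fun k => (k < p)%N) 'I_p i, @insub _ (fun k => (k < p)%N) 'I_p j with
  | Some i', Some j' => A i' j'
  | _, _ => 0
  end.

(* Kronecker product A (x) B (standard convention: the index of B runs fastest) *)
Definition kron (p q : nat) (A : 'M[R]_p) (B : 'M[R]_q) : 'M[R]_(p * q) :=
  \matrix_(k, l) (mxn A (k %/ q) (l %/ q) * mxn B (k %% q) (l %% q)).

(* The amplification matrix G of both schemes. *)
Definition Cx (pq : pq_choice) (alpha : R) (Nx Ny : nat) : 'M[R]_(Ny.-1 * Nx.-1) :=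
  kron 1%:M (Cmat pq alpha Nx).
Definition Cy (pq : pq_choice) (beta : R) (Nx Ny : nat) : 'M[R]_(Ny.-1 * Nx.-1) :=
  kron (Cmat pq beta Ny) 1%:M.
Definition Dx (pq : pq_choice) (alpha K1p K2p tau h : R) (Nx Ny : nat)
  : 'M[R]_(Ny.-1 * Nx.-1) :=
  (tau / (2 * h `^ alpha)) *:
    kron 1%:M (K1p *: Amat pq alpha Nx + K2p *: (Amat pq alpha Nx)^T).
Definition Dy (pq : pq_choice) (beta K1m K2m tau h : R) (Nx Ny : nat)
  : 'M[R]_(Ny.-1 * Nx.-1) :=
  (tau / (2 * h `^ beta)) *:
    kron (K1m *: Amat pq beta Ny + K2m *: (Amat pq beta Ny)^T) 1%:M.

Definition Gmat (pq : pq_choice) (alpha beta K1p K2p K1m K2m tau h : R) (Nx Ny : nat)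
  : 'M[R]_(Ny.-1 * Nx.-1) :=
  let cx := Cx pq alpha Nx Ny in let cy := Cy pq beta Nx Ny in
  let dx := Dx pq alpha K1p K2p tau h Nx Ny in
  let dy := Dy pq beta K1m K2m tau h Nx Ny in
  invmx (cy - dy) *m invmx (cx - dx) *m (cx + dx) *m (cy + dy).

Definition uncond_stable (pq : pq_choice) (alpha beta K1p K2p K1m K2m : R) : Prop :=
  forall (tau h : R) (Nx Ny : nat), 0 < tau -> 0 < h -> (0 < Nx)%N -> (0 < Ny)%N ->
    (Cy pq beta Nx Ny - Dy pq beta K1m K2m tau h Nx Ny \in unitmx) /\
    (Cx pq alpha Nx Ny - Dx pq alpha K1p K2p tau h Nx Ny \in unitmx) /\
    (forall i j, (fun n : nat => ((Gmat pq alpha beta K1p K2p K1m K2m tau h Nx Ny) ^+ n) i j)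
                   @ \oo --> (0 : R)).

Definition admissible (pq : pq_choice) (gamma : R) : Prop :=
  match pq with
  | PQ10 => 1 < gamma <= 2
  | PQ1m1 => (1 + Num.sqrt 73) / 6 <= gamma <= 2
  end.

End Scheme.

(* Main.v *)
(** The amplification matrix factors as a Kronecker product
  [G = P_beta *t P_alpha] of one-dimensional Crank-Nicolson matrices
  [P = (C - D)^-1 (C + D)], so it suffices that the powers of each factor tend
  to [0].  If [C] is symmetric and both [C] and [- D] have coercive quadratic
  forms, the energy [x^T C x] decreases along an orbit [x_n] of [P], by at least
  a multiple of [|x_n + x_(n+1)|^2]; hence [x_n + x_(n+1)] tends to [0], and so
  does [x_n = 2^-1 C^-1 (C - D) (x_n + x_(n+1))].

  For coercivity, extend [x] by zero to the integers and let
  [r d = \sum_i x_i x_(i + d)].  A Toeplitz form with symbol weights [w] equals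
  [w_0 r(1) + \sum_k w_(k+1) r(k)].  The partial sums of at least
  four weights are nonpositive, [w_k >= 0] for [k >= 4], and the possibly negative [w_3] is absorbed through
  [r(0) - r(2) <= 4 (r(0) - r(1))], which leaves a negative multiple of
  [r(0) - r(1)]; a discrete Poincare inequality bounds this by [r(0)].  The
  lower bound on the order for [(p,q) = (1,-1)] is exactly [c^gamma <= 1/4],
  which makes [C] positive definite. *)
Require Import Defs.
From HB Require Import structures.
From mathcomp Require Import all_boot all_order all_algebra.
From mathcomp Require Import all_classical all_reals all_analysis.
From mathcomp Require Import ring lra zify.
From mathcomp Require Import mxtens.
Import Order.TTheory GRing.Theory Num.Theory.
Import numFieldNormedType.Exports.
Local Open Scope ring_scope.

(** * Autocorrelations of finitely supported sequences and Toeplitz forms *)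

Section Autocorrelation.
Context {R : realFieldType} (p : nat) (X : nat -> R).
Hypothesis X_out : forall i, (p <= i)%N -> X i = 0.

Definition autocorr (d : nat) : R := \sum_(i < p) X i * X (i + d)%N.

Lemma sum_shift_sqr d :
  \sum_(i < p) X i ^+ 2 = \sum_(i < d) X i ^+ 2 + \sum_(i < p) X (i + d)%N ^+ 2.
Proof.
have tail n : (p <= n)%N -> \sum_(i < n) X i ^+ 2 = \sum_(i < p) X i ^+ 2.
  move=> pn; rewrite -(subnKC pn) big_split_ord /= [X in _ + X]big1 ?addr0 //.
  by move=> i _; rewrite X_out ?leq_addr // expr0n.
rewrite -(tail (d + p)%N) ?leq_addl // big_split_ord /=; congr (_ + _).
by apply: eq_bigr => i _; rewrite addnC.
Qed.

Lemma autocorr0 : autocorr 0 = \sum_(i < p) X i ^+ 2.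
Proof. by apply: eq_bigr => i _; rewrite addn0 expr2. Qed.

Lemma autocorr0_ge0 : 0 <= autocorr 0.
Proof. by rewrite autocorr0 sumr_ge0 // => i _; rewrite sqr_ge0. Qed.

(** This expands a sum of squares over all integers [i]: the indices from [-d] to [-1], where [X i]
    is zero, contribute the first [d] squares. *)
Lemma sum_diff_sqr (s : R) d : s ^+ 2 = 1 ->
  \sum_(i < d) X i ^+ 2 + \sum_(i < p) (X i - s * X (i + d)%N) ^+ 2
  = 2 * (autocorr 0 - s * autocorr d).
Proof.
move=> s2; have /esym E := sum_shift_sqr d.
have -> : \sum_(i < p) (X i - s * X (i + d)%N) ^+ 2
  = \sum_(i < p) X i ^+ 2 + \sum_(i < p) X (i + d)%N ^+ 2 - 2 * s * autocorr d.
  rewrite -big_split /= mulr_sumr -sumrB; apply: eq_bigr => i _.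
  by rewrite sqrrB exprMn s2; ring.
by rewrite autocorr0; move: E; lra.
Qed.

Lemma autocorr_le0 d : autocorr d <= autocorr 0.
Proof.
have := @sum_diff_sqr 1 d (expr1n _ _); rewrite mul1r => E.
have : 0 <= 2 * (autocorr 0 - autocorr d); last by lra.
by rewrite -E addr_ge0 // sumr_ge0 // => i _; rewrite sqr_ge0.
Qed.

(* [s = 1] serves the diffusion matrices, [s = -1] the mass matrices. *)
Lemma autocorr1_poincare (s : R) : s ^+ 2 = 1 ->
  autocorr 0 <= 3 ^+ p * (2 * (autocorr 0 - s * autocorr 1)).
Proof.
move=> s2; rewrite -sum_diff_sqr // big_ord1.
under eq_bigr do rewrite addn1.
suff H : \sum_(i < p) X i ^+ 2 <= 3 ^+ p * \sum_(i < p) (X i - s * X i.+1) ^+ 2.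
  rewrite autocorr0 (le_trans H) // ler_pM2l ?exprn_gt0 //.
  by rewrite lerDr sqr_ge0.
have : X p = 0 by rewrite X_out.
(* Only [X p = 0] is kept, since the shifted sequence inherits it in the induction. *)
clear X_out; elim: p X => [|n IH] Y Yn; first by rewrite !big_ord0 mulr0.
rewrite !big_ord_recl /= /bump /=.
have := IH (fun i => Y i.+1) Yn; rewrite -[\sum_(i < n) Y _ ^+ 2]/(\sum_(i < n) Y i.+1 ^+ 2).
rewrite -[\sum_(i < n) (Y (1 + i)%N - _) ^+ 2]/(\sum_(i < n) (Y i.+1 - s * Y i.+2) ^+ 2).
set S := \sum_(i < n) _; set D := \sum_(i < n) _ => SD.
have Y1S : Y 1%N ^+ 2 <= S.
  rewrite /S; case: {IH SD S D} n Yn => [->|m _]; first by rewrite big_ord0 expr0n.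
  by rewrite big_ord_recl lerDl sumr_ge0 // => i _; rewrite sqr_ge0.
have p3 : 1 <= 3 ^+ n :> R by rewrite exprn_ege1 // ler1n.
set d := Y 0%N - s * Y 1%N.
(* As [Y 0 = d + s * Y 1], this gives [Y 0 ^+ 2 + S <= 2 * d ^+ 2 + 3 * S]: a factor 3 per entry. *)
have Y0 : Y 0%N ^+ 2 <= 2 * d ^+ 2 + 2 * Y 1%N ^+ 2.
  have <- : (s * Y 1%N) ^+ 2 = Y 1%N ^+ 2 by rewrite exprMn s2 mul1r.
  by rewrite /d; have := sqr_ge0 (Y 0%N - 2 * (s * Y 1%N)); lra.
have d_ge0 := sqr_ge0 d; rewrite [3 ^+ n.+1]exprS.
move: (d ^+ 2) (3 ^+ n) d_ge0 Y0 p3 SD => d2 t d_ge0 Y0 t_ge1 SD.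
have := ler_peMl d_ge0 t_ge1; lra.
Qed.

(** A difference over two steps is a sum of two one-step differences, and
    [(a + b)^2 <= 2 a^2 + 2 b^2]. *)
Lemma autocorr2_bound : autocorr 0 - autocorr 2 <= 4 * (autocorr 0 - autocorr 1).
Proof.
have := @sum_diff_sqr 1 2 (expr1n _ _); have := @sum_diff_sqr 1 1 (expr1n _ _).
rewrite !mul1r big_ord1 !big_ord_recr big_ord0 /= add0r => E1 E2.
have : \sum_(i < p) (X i - 1 * X (i + 2)%N) ^+ 2 <=
  \sum_(i < p) (2 * (X i - 1 * X (i + 1)%N) ^+ 2 + 2 * (X i.+1 - X i.+2) ^+ 2).
  apply: ler_sum => i _; rewrite !mul1r addn1 addn2.
  have := sqr_ge0 (X i - 2 * X i.+1 + X i.+2); nra.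
rewrite big_split /= -!mulr_sumr.
have -> : \sum_(i < p) (X i.+1 - X i.+2) ^+ 2 =
   \sum_(i < p) (X i - 1 * X (i + 1)%N) ^+ 2 - (X 0%N - X 1%N) ^+ 2.
  case: p X_out => [|n] Xo; first by rewrite !big_ord0 !Xo // subrr expr0n subrr.
  rewrite big_ord_recr big_ord_recl /= (Xo n.+1) // (Xo n.+2) // subrr expr0n /=.
  rewrite addr0 !mul1r [RHS]addrAC subrr add0r; apply: eq_bigr => i _.
  by rewrite mul1r /bump /= add1n addn1.
set D := \sum_(i < p) _ in E1 *; move: E1 E2.
set D2 := \sum_(i < p) _ => E1 E2 le.
(* The leftover boundary terms are [5 X0^2 - 4 X0 X1 + X1^2 = (2 X0 - X1)^2 + X0^2]. *)
have := sqr_ge0 (2 * X 0%N - X 1%N); have := sqr_ge0 (X 0%N); nra.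
Qed.

(** Entries are grouped by diagonal: [w 0] sits on the superdiagonal and [w k.+1] on the [k]-th
    subdiagonal. [n] may exceed [p] because [autocorr k] vanishes for [k >= p]. *)
Lemma toeplitz_form (w : nat -> R) n : (p <= n)%N ->
  \sum_(i < p) \sum_(j < p)
     (if (j <= i.+1)%N then w (i.+1 - j)%N else 0) * (X i * X j)
  = w 0%N * autocorr 1 + \sum_(k < n) w k.+1 * autocorr k.
Proof.
move=> pn.
have E i j : (i < p)%N -> (j < p)%N ->
   (if (j <= i.+1)%N then w (i.+1 - j)%N else 0) * (X i * X j)
   = (if j == i.+1 then w 0%N * (X i * X i.+1) else 0)
     + \sum_(k < n) (if i == (j + k)%N then w k.+1 * (X j * X (j + k)%N) else 0).
  move=> ip jp; have [ji|ji|->] := ltngtP j i.+1.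
  - rewrite add0r subSn //.
    have kn : (i - j < n)%N by lia.
    rewrite (bigD1 (Ordinal kn)) //= subnKC // eqxx big1 ?addr0; first by ring.
    move=> k /eqP kk; case: eqP => // ik; case: kk; apply: val_inj => /=; lia.
  - by rewrite mul0r add0r big1 // => k _; case: eqP => // ik; lia.
  - rewrite subnn big1 ?addr0 // => k _; case: eqP => // ik; lia.
under eq_bigr => i _.
  under eq_bigr => j _ do rewrite E //.
  rewrite big_split /=; over.
rewrite big_split /=; congr (_ + _).
  rewrite /autocorr mulr_sumr; apply: eq_bigr => i _; rewrite addn1.
  have [ip|ip] := ltnP i.+1 p.
    rewrite (bigD1 (Ordinal ip)) //= eqxx big1 ?addr0 // => j /eqP jk.
    by case: eqP => // ij; case: jk; apply: val_inj.
  rewrite (X_out _ ip) !mulr0 big1 // => j _; by case: ifP.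
rewrite exchange_big /=.
under eq_bigr => j _ do rewrite exchange_big /=.
rewrite exchange_big /=; apply: eq_bigr => k _.
rewrite /autocorr mulr_sumr; apply: eq_bigr => j _.
have [ip|ip] := ltnP (j + k) p.
  rewrite (bigD1 (Ordinal ip)) //= eqxx big1 ?addr0 // => i /eqP jk.
  by case: eqP => // ij; case: jk; apply: val_inj.
rewrite (X_out _ ip) !mulr0 big1 // => i _; by case: ifP.
Qed.

(** With [r k] for [autocorr k]: raising [r k] to [r 0] for [k >= 3] and using the nonpositive total
    weight leaves [-(w 0 + w 2)(r 0 - r 1) - w 3 (r 0 - r 2)]. The two upper bounds on [mu] serve
    the two signs of [w 3]. *)
Lemma autocorr_weighted_le (w : nat -> R) n (mu : R) :
  \sum_(k < n.+3.+1) w k <= 0 ->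
  (forall k, (4 <= k)%N -> 0 <= w k) ->
  0 <= mu -> mu <= w 0%N + w 2%N -> mu <= w 0%N + w 2%N + 4 * w 3%N ->
  w 0%N * autocorr 1 + \sum_(k < n.+3) w k.+1 * autocorr k
   <= - mu * (autocorr 0 - autocorr 1).
Proof.
rewrite !big_ord_recl /= /bump /= !add1n => sw w4 mu0 m1 m2.
set S := \sum_(i < n) _ in sw; set T := \sum_(i < n) _.
have TS : T <= S * autocorr 0.
  rewrite /T /S mulr_suml; apply: ler_sum => i _.
  by apply: ler_wpM2l; rewrite ?w4 ?autocorr_le0.
have e1 := autocorr_le0 1; have e2 := autocorr_le0 2; have b2 := autocorr2_bound.
have := autocorr0_ge0.
move: e1 e2 b2 TS; set r0 := autocorr 0; set r1 := autocorr 1; set r2 := autocorr 2.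
move=> e1 e2 b2 TS r0_ge0.
have w3 : w 3%N * (r2 - r0) <= - (mu - (w 0%N + w 2%N)) * (r0 - r1).
  have [w3|w3] := lerP 0 (w 3%N).
    have : 0 <= w 3%N * (r0 - r2) by rewrite mulr_ge0 // subr_ge0.
    have : 0 <= (w 0%N + w 2%N - mu) * (r0 - r1) by rewrite mulr_ge0 // subr_ge0.
    lra.
  have : 0 <= - w 3%N * (4 * (r0 - r1) - (r0 - r2)).
    by rewrite mulr_ge0 // ?oppr_ge0 ?subr_ge0 // ltW.
  have : 0 <= (w 0%N + w 2%N + 4 * w 3%N - mu) * (r0 - r1) by rewrite mulr_ge0 // subr_ge0.
  lra.
have := mulr_le0_ge0 sw r0_ge0; nra.
Qed.

End Autocorrelation.

(** * Signs and partial sums of the weights *)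

Section Weights.
Context {R : realType}.
Implicit Types gamma : R.

Lemma gcoef0 gamma : gcoef gamma 0 = 1.
Proof. by rewrite /gcoef /gbinom big_ord0 expr0 fact0 divr1 mul1r. Qed.

Lemma gcoefS gamma k : k.+1%:R * gcoef gamma k.+1 = (k%:R - gamma) * gcoef gamma k.
Proof.
rewrite /gcoef /gbinom big_ord_recr /= factS natrM exprS.
have k1 : k.+1%:R != 0 :> R by rewrite pnatr_eq0.
have kf : (k`!)%:R != 0 :> R by rewrite pnatr_eq0 -lt0n fact_gt0.
by field; rewrite kf addrC natr1.
Qed.

(** In the recurrence the factors [- gamma] and [1 - gamma] are nonpositive, and [k - gamma] is
    nonnegative from [k = 2] on. *)
Lemma gcoef_ge0 gamma k : 1 <= gamma <= 2 -> 0 <= gcoef gamma k.+2.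
Proof.
move=> /andP[g1 g2]; elim: k => [|k IH].
  have := gcoefS gamma 1; have := gcoefS gamma 0; rewrite gcoef0; nra.
have := gcoefS gamma k.+2; move=> E.
rewrite -(pmulr_rge0 _ (ltr0Sn R k.+2)) E mulr_ge0 // subr_ge0.
by rewrite (le_trans g2) // ler_nat.
Qed.

(** The partial sum is the coefficient [gcoef (gamma - 1) n]; in terms of [gcoef gamma n.+1] its
    sign is already known. *)
Lemma gcoef_sum gamma n :
  gamma * \sum_(k < n.+1) gcoef gamma k = - (n.+1%:R * gcoef gamma n.+1).
Proof.
elim: n => [|n IH]; first by rewrite gcoefS big_ord1 sub0r mulNr opprK.
rewrite big_ord_recr /= mulrDr IH (gcoefS gamma n.+1); ring.
Qed.

Lemma gcoef_sum_le0 gamma n : 1 <= gamma <= 2 -> \sum_(k < n.+2) gcoef gamma k <= 0.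
Proof.
move=> g; have g0 : 0 < gamma by case/andP: g => g1 _; rewrite (lt_le_trans ltr01).
rewrite -(pmulr_rle0 _ g0) gcoef_sum oppr_le0 mulr_ge0 ?gcoef_ge0 //.
Qed.

(** The weights are convex combinations of [gcoef] and a shifted copy. A shift by two leaves two of
    four terms, the fewest with a nonpositive sum. *)
Lemma wcoef_sum_le0 pq gamma n : 1 <= gamma <= 2 ->
  \sum_(k < n.+4) wcoef pq gamma k <= 0.
Proof.
move=> g; have [g1 g2] := andP g; case: pq.
  rewrite big_ord_recl /= big_split /= -!mulr_sumr addrA.
  have -> : gamma / 2 * gcoef gamma 0 + gamma / 2 * \sum_(i < n.+3) gcoef gamma (bump 0 i)
     = gamma / 2 * \sum_(i < n.+4) gcoef gamma i by rewrite -mulrDr [in RHS]big_ord_recl.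
  by rewrite -[leRHS]addr0 lerD ?mulr_ge0_le0 ?gcoef_sum_le0 //; lra.
rewrite 2!big_ord_recl /= big_split /= -!mulr_sumr !addrA.
set T := \sum_(i < n.+2) gcoef gamma (bump _ _).
have -> : (2 + gamma) / 4 * gcoef gamma 0 + (2 + gamma) / 4 * gcoef gamma 1 + (2 + gamma) / 4 * T
     = (2 + gamma) / 4 * \sum_(i < n.+4) gcoef gamma i.
  by rewrite 2![in RHS]big_ord_recl /= /bump !add1n /T; ring.
by rewrite -[leRHS]addr0 lerD ?mulr_ge0_le0 ?gcoef_sum_le0 //; lra.
Qed.

Lemma wcoef_ge0 pq gamma k : 1 <= gamma <= 2 -> 0 <= wcoef pq gamma k.+4.
Proof.
move=> g; have [g1 g2] := andP g.
by case: pq; rewrite /= addr_ge0 // mulr_ge0 ?gcoef_ge0 //; lra.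
Qed.

Lemma admissible_bounds pq gamma : admissible pq gamma ->
  [/\ 1 < gamma, gamma <= 2, 0 < ccoef pq gamma & ccoef pq gamma <= 4^-1].
Proof.
case: pq => /= /andP[g1 g2]; first by split => //; nra.
(* This crude bound yields [gamma >= 3/2], hence [1 < gamma]. *)
have s8 : 8 <= Num.sqrt 73 :> R.
  by rewrite -[8]ger0_norm // -sqrtr_sqr ler_sqrt //; lra.
have s2 : Num.sqrt 73 ^+ 2 = 73 :> R by rewrite sqr_sqrtr.
move: (Num.sqrt 73) s8 s2 g1 => s s8 s2 g1.
(* Equivalently [3 gamma^2 - gamma >= 6], which is [ccoef <= 1/4]. *)
have : 73 <= (6 * gamma - 1) ^+ 2 by rewrite -s2 ler_sqr ?nnegrE; lra.
by move=> g3; split; nra.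
Qed.

Lemma wcoef_margin pq gamma : admissible pq gamma ->
  exists mu : R, [/\ 0 < mu, mu <= wcoef pq gamma 0 + wcoef pq gamma 2 &
    mu <= wcoef pq gamma 0 + wcoef pq gamma 2 + 4 * wcoef pq gamma 3].
Proof.
move=> /[dup] adm /admissible_bounds[g1 g2 c0 c1].
have G1 : gcoef gamma 1 = - gamma.
  by have := gcoefS gamma 0; rewrite gcoef0; lra.
have G2 : gcoef gamma 2 = gamma * (gamma - 1) / 2.
  by have := gcoefS gamma 1; rewrite G1; lra.
have G3 : gcoef gamma 3 = gamma * (gamma - 1) * (2 - gamma) / 6.
  by have := gcoefS gamma 2; rewrite G2; lra.
case: pq adm c0 c1 => /= [_ _ _|_ _ c1].
  (* This is [w 0 + w 2] itself; the product shown nonnegative below is [w 3]. *)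
  exists (gamma * (gamma + 2) * (gamma - 1) / 4); rewrite G1 G2 G3 gcoef0.
  split; first by rewrite !mulr_gt0; lra.
    lra.
  have : 0 <= gamma * (2 - gamma) * (gamma - 1) * (gamma + 3) / 12.
    by rewrite !mulr_ge0; lra.
  lra.
(* Here [w 3 = gamma (2 - gamma)(gamma^2 + gamma - 8) / 24] is nonpositive; [1/4] is a convenient
   margin, not a sharp one. *)
by exists (1 / 4); rewrite G1 G2 G3 gcoef0; split; [lra|nra|nra].
Qed.

End Weights.

Local Open Scope classical_set_scope.

(** * Coercive forms and decay of the Crank-Nicolson iteration *)

Section QuadraticForms.
Context {R : realType} {p : nat}.
Implicit Types (M C D : 'M[R]_p) (x y : 'cV[R]_p).

Definition qform M x : R := (x^T *m M *m x) 0 0.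

(** [qform 1%:M] is the squared Euclidean norm. Symmetry is not demanded, as [C - D] need not be
    symmetric. *)
Definition coercive M := exists2 d : R, 0 < d & forall x, d * qform 1%:M x <= qform M x.

Lemma qformE M x : qform M x = \sum_i \sum_j M i j * (x i 0 * x j 0).
Proof.
rewrite /qform mxE exchange_big /=; apply: eq_bigr => i _.
rewrite mxE mulr_suml; apply: eq_bigr => j _.
by rewrite mxE; ring.
Qed.

Lemma qform1 x : qform 1%:M x = \sum_i x i 0 ^+ 2.
Proof.
by rewrite /qform mulmx1 mxE; apply: eq_bigr => i _; rewrite mxE expr2.
Qed.

Lemma qform1_ge0 x : 0 <= qform 1%:M x.
Proof. by rewrite qform1 sumr_ge0 // => i _; rewrite sqr_ge0. Qed.

Lemma qform1_eq0 x : (qform 1%:M x == 0) = (x == 0).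
Proof.
rewrite qform1 psumr_eq0; last by move=> i _; rewrite sqr_ge0.
apply/allP/eqP => [x0|-> i _]; last by rewrite mxE expr0n /= eqxx.
apply/colP => i; have := x0 i (mem_index_enum i).
by rewrite /= sqrf_eq0 mxE => /eqP.
Qed.

Lemma qformDl M1 M2 x : qform (M1 + M2) x = qform M1 x + qform M2 x.
Proof. by rewrite /qform mulmxDr mulmxDl mxE. Qed.

Lemma qformZl a M x : qform (a *: M) x = a * qform M x.
Proof. by rewrite /qform -scalemxAr -scalemxAl mxE. Qed.

Lemma qformNl M x : qform (- M) x = - qform M x.
Proof. by rewrite /qform mulmxN mulNmx mxE. Qed.

Lemma qform_tr M x : qform M^T x = qform M x.
Proof.
rewrite /qform -[in LHS](trmxK x) -!trmx_mul mulmxA.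
by rewrite [LHS]mxE trmxK.
Qed.

Lemma coerciveD M1 M2 : coercive M1 -> coercive M2 -> coercive (M1 + M2).
Proof.
move=> [d1 d1_gt0 H1] [d2 d2_gt0 H2]; exists (d1 + d2); first exact: addr_gt0.
by move=> x; rewrite mulrDl qformDl lerD.
Qed.

Lemma coercive_unitmx M : coercive M -> M \in unitmx.
Proof.
move=> [d d_gt0 dM]; rewrite -unitmx_tr -row_free_unit; apply/inj_row_free => v vM.
suff : v^T == 0 by rewrite trmx_eq0 => /eqP.
rewrite -qform1_eq0 eq_le qform1_ge0 andbT -(pmulr_rle0 _ d_gt0).
rewrite (le_trans (dM _)) // /qform -mulmxA.
suff -> : M *m v^T = 0 by rewrite mulmx0 mxE.
by rewrite -[M]trmxK -trmx_mul vM trmx0.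
Qed.

(* The [C]-energy drops by the dissipation [- qform D] at the midpoint. *)
Lemma crank_nicolson_energy C D x y : C^T = C ->
  (C - D) *m y = (C + D) *m x -> qform C y = qform C x + qform D (x + y).
Proof.
move=> Csym; rewrite mulmxBl mulmxDl => /eqP; rewrite subr_eq => /eqP E.
have {}E : D *m (x + y) = C *m y - C *m x.
  by apply/esym/eqP; rewrite mulmxDr E subr_eq [X in _ == X]addrC addrA.
have sym : (x^T *m C *m y) 0 0 = (y^T *m C *m x) 0 0.
  transitivity ((x^T *m C *m y)^T 0 0); first by rewrite [RHS]mxE.
  by rewrite !trmx_mul trmxK Csym mulmxA.
have -> : qform D (x + y) = ((x + y)^T *m (C *m y - C *m x)) 0 0.
  by rewrite -E mulmxA.
rewrite [(x + y)^T]linearD /= mulmxDl !mulmxBr !mulmxA.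
by rewrite /qform; move: sym; rewrite !mxE; lra.
Qed.

Lemma crank_nicolson_cvg0 C D : C^T = C -> coercive C -> coercive (- D) ->
  forall i j, (fun n => ((invmx (C - D) *m (C + D)) ^+ n) i j) @ \oo --> (0 : R).
Proof.
move=> Csym Cco Dco i j.
have CDu : C - D \in unitmx by apply/coercive_unitmx/coerciveD.
have Cu := coercive_unitmx _ Cco.
set P := invmx _ *m _.
(* The orbit of a basis vector runs through the [j]-th columns of the powers of [P]. *)
pose x n : 'cV[R]_p := P ^+ n *m delta_mx j 0.
have xS n : (C - D) *m x n.+1 = (C + D) *m x n.
  by rewrite /x exprS -mulmxE -mulmxA /P -!mulmxA mulKVmx.
have [d d_gt0 dC] := Cco; have [e e_gt0 eD] := Dco.
pose z n := x n + x n.+1.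
have En n : qform C (x n.+1) = qform C (x n) + qform D (z n).
  exact: crank_nicolson_energy.
have dissip n : e * qform 1%:M (z n) <= qform C (x n) - qform C (x n.+1).
  by rewrite En; have := eD (z n); rewrite qformNl; lra.
(* The energy decreases and is nonnegative, so it converges and its successive differences tend to
   0. *)
have Ecvg : cvgn (fun n => qform C (x n)).
  apply: nonincreasing_is_cvgn.
    apply/nonincreasing_seqP => n; rewrite -subr_ge0.
    by rewrite (le_trans _ (dissip n)) // mulr_ge0 ?qform1_ge0 // ltW.
  exists 0 => _ [n _ <-]; rewrite (le_trans _ (dC _)) //.
  by rewrite mulr_ge0 ?qform1_ge0 // ltW.
have diff0 : (fun n => e^-1 * (qform C (x n) - qform C (x n.+1))) @ \oo --> (0 : R).
  rewrite -[X in _ --> X](mulr0 e^-1) -(subrr (limn (fun n => qform C (x n)))).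
  apply: cvgMl_tmp; apply: cvgB; first exact: Ecvg.
  by rewrite (cvg_shiftS (fun n => qform C (x n))).
have z0 k : (fun n => z n k 0) @ \oo --> (0 : R).
  have zz n : z n k 0 ^+ 2 <= e^-1 * (qform C (x n) - qform C (x n.+1)).
    rewrite ler_pdivlMl // (le_trans _ (dissip n)) // ler_pM2l // qform1.
    by rewrite (bigD1 k) //= lerDl sumr_ge0 // => l _; rewrite sqr_ge0.
  have sq0 : (fun n => z n k 0 ^+ 2) @ \oo --> (0 : R).
    apply: squeeze_cvgr (cvg_cst 0) diff0; near=> n.
    by rewrite sqr_ge0 zz.
  apply: norm_cvg0.
  rewrite -[X in _ --> X]sqrtr0.
  under eq_fun do rewrite -sqrtr_sqr.
  by apply: continuous_cvg => //; exact: sqrt_continuous.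
(* By [xS], [(C - D)(x n + x n.+1) = (C - D) x n + (C + D) x n = 2 C x n]. *)
have xz n : x n = (2^-1 *: (invmx C *m (C - D))) *m z n.
  rewrite -scalemxAl -mulmxA mulmxDr xS -mulmxDl addrACA addNr addr0 mulmxDl.
  by rewrite mulmxDr mulKmx // -mulr2n -(scaler_nat 2 (x n)) scalerA mulVf ?scale1r ?pnatr_eq0 //.
have Pz n : (P ^+ n) i j = \sum_k (2^-1 *: (invmx C *m (C - D))) i k * z n k 0.
  transitivity (x n i 0); last by rewrite xz mxE.
  rewrite /x mxE (bigD1 j) //= big1 ?addr0 => [|k kj]; rewrite mxE ?eqxx ?mulr1 //.
  by rewrite (negbTE kj) mulr0.
apply: cvg_trans (near_eq_cvg _) _; last first.
  suff : (fun n => \sum_k (2^-1 *: (invmx C *m (C - D))) i k * z n k 0) @ \oo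
      --> \sum_(k < p) (2^-1 *: (invmx C *m (C - D))) i k * 0.
    by rewrite [X in _ --> X]big1 => [|k _]; [exact|rewrite mulr0].
  by apply: cvg_big => [|k _]; [exact: add_continuous|exact: cvgMl_tmp].
by near=> n; rewrite Pz.
Unshelve. all: by end_near.
Qed.

End QuadraticForms.

(** * Coercivity of the mass and diffusion matrices *)

Section SchemeMatrices.
Context {R : realType}.

Definition zero_ext {p} (x : 'cV[R]_p) (i : nat) : R :=
  if insub i is Some k then x k 0 else 0.

Lemma zero_ext_ord {p} (x : 'cV[R]_p) (i : 'I_p) : zero_ext x i = x i 0.
Proof. by rewrite /zero_ext valK. Qed.

Lemma zero_ext_out {p} (x : 'cV[R]_p) i : (p <= i)%N -> zero_ext x i = 0.
Proof. by rewrite leqNgt => pi; rewrite /zero_ext insubN. Qed.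

Lemma qform1_autocorr {p} (x : 'cV[R]_p) :
  qform 1%:M x = autocorr p (zero_ext x) 0.
Proof.
by rewrite qform1 autocorr0; apply: eq_bigr => i _; rewrite zero_ext_ord.
Qed.

Lemma coercive_NAmat pq (gamma : R) m :
  admissible pq gamma -> coercive (- Amat pq gamma m).
Proof.
move=> adm; have [mu [mu0 mu1 mu2]] := wcoef_margin _ _ adm.
have [g1 g2 _ _] := admissible_bounds _ _ adm.
have g12 : 1 <= gamma <= 2 by rewrite g2 ltW.
set p := m.-1; have t_gt0 : 0 < 2 * 3 ^+ p :> R by rewrite mulr_gt0 ?exprn_gt0.
exists (mu / (2 * 3 ^+ p)) => [|x]; first by rewrite divr_gt0.
have Xo := zero_ext_out x; have := autocorr1_poincare _ _ Xo 1 (expr1n _ _).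
rewrite qform1_autocorr qformNl qformE mul1r.
rewrite mulrCA mulrA => P.
under eq_bigr => i _ do under eq_bigr => j _ do
  rewrite mxE -(zero_ext_ord x i) -(zero_ext_ord x j).
(* The range is padded by three so that at least four weights occur, whatever the matrix size. *)
rewrite (toeplitz_form _ _ Xo (wcoef pq gamma) m.-1.+3); last by rewrite !leqW.
have := autocorr_weighted_le _ _ Xo (wcoef pq gamma) m.-1 mu
  (wcoef_sum_le0 pq gamma _ g12) _ (ltW mu0) mu1 mu2.
have w4 k : (4 <= k)%N -> 0 <= wcoef pq gamma k.
  by case: k => [|[|[|[|k]]]] // _; exact: wcoef_ge0.
move=> /(_ w4); rewrite mulNr -lerNr; apply: le_trans.
by rewrite mulrAC ler_pdivrMr // -mulrA ler_pM2l // [leRHS]mulrC.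
Qed.

(** The form is [(1 - 4 c) r 0 + 2 c (r 0 + r 1)]. The first term is nonnegative for [c <= 1/4]; the
    second is coercive by the Poincare inequality with [s = -1], even at [c = 1/4]. *)
Lemma coercive_Cmat pq (gamma : R) m :
  admissible pq gamma -> coercive (Cmat pq gamma m).
Proof.
move=> adm; have [_ _ c0 c4] := admissible_bounds _ _ adm.
set c := ccoef pq gamma in c0 c4.
set p := m.-1; have t_gt0 : 0 < 2 * 3 ^+ p :> R by rewrite mulr_gt0 ?exprn_gt0.
exists (2 * c / (2 * 3 ^+ p)) => [|x]; first by rewrite divr_gt0 ?mulr_gt0.
have Xo := zero_ext_out x.
have N1_sqr : (-1) ^+ 2 = 1 :> R by rewrite sqrrN expr1n.
have := autocorr1_poincare _ _ Xo (-1) N1_sqr.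
have := autocorr0_ge0 p (zero_ext x).
rewrite qform1_autocorr qformE mulN1r opprK mulrCA mulrA.
(* A tridiagonal Toeplitz matrix has the shape of [Amat] with three weights. *)
pose w k : R := nth 0 [:: c; 1 - 2 * c; c] k.
under eq_bigr => i _ do under eq_bigr => j _ do
  rewrite mxE -(zero_ext_ord x i) -(zero_ext_ord x j).
have -> : \sum_(i < m.-1) \sum_(j < m.-1)
    ((i == j)%:R + ccoef pq gamma *
      (if i == j then -2 else if (i.+1 == j) || (j.+1 == i) then 1 else 0))
      * (zero_ext x i * zero_ext x j)
  = \sum_(i < m.-1) \sum_(j < m.-1)
     (if (j <= i.+1)%N then w (i.+1 - j)%N else 0) * (zero_ext x i * zero_ext x j).
  apply: eq_bigr => i _; apply: eq_bigr => j _; congr (_ * _).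
  rewrite -/c -val_eqE /=.
  have [ij|ij|ij] := ltngtP (i : nat) j.
  - rewrite (_ : (j.+1 == i) = false) ?orbF; last lia.
    have [<-|ij'] := eqVneq i.+1 (j : nat); first by rewrite leqnn subnn /w /= mulr1 add0r.
    by rewrite ifF ?mulr0 ?addr0 //; lia.
  - rewrite (_ : (i.+1 == j) = false) /=; last lia.
    rewrite (leqW (ltnW ij)).
    have [<-|ij'] := eqVneq j.+1 (i : nat); first by rewrite -addn2 addKn /w /= mulr1 add0r.
    rewrite mulr0 addr0 /w nth_default //=; lia.
  - by rewrite ij leqnSn subSnn /w /=; ring.
rewrite (toeplitz_form _ _ Xo w m.-1.+2); last by rewrite !leqW.
rewrite !big_ord_recl /= big1 ?addr0 => [|k _]; last by rewrite /w nth_default ?mul0r.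
rewrite /w /=.
set r0 := autocorr _ _ 0; set r1 := autocorr _ _ 1.
move=> r0_ge0 P.
have : 0 <= (1 - 4 * c) * r0 by rewrite mulr_ge0 //; lra.
rewrite mulrAC; suff : 2 * c * r0 / (2 * 3 ^+ p) <= 2 * c * (r0 + r1) by rewrite /bump /=; lra.
rewrite ler_pdivrMr // -!mulrA !ler_pM2l //.
by rewrite [leRHS]mulrC.
Qed.

Lemma tr_Cmat pq (gamma : R) m : (Cmat pq gamma m)^T = Cmat pq gamma m.
Proof. by apply/matrixP => i j; rewrite !mxE eq_sym orbC. Qed.

(** A matrix and its transpose have the same form, so the two-sided operator acts as [K1 + K2 > 0]
    times the one-sided one. *)
Lemma coercive_diffusion pq (gamma K1 K2 s : R) m : admissible pq gamma ->
  0 <= K1 -> 0 <= K2 -> K1 ^+ 2 + K2 ^+ 2 != 0 -> 0 < s ->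
  coercive (- (s *: (K1 *: Amat pq gamma m + K2 *: (Amat pq gamma m)^T))).
Proof.
move=> adm K1_ge0 K2_ge0 K_neq0 s_gt0.
have [d d_gt0 dA] := coercive_NAmat pq gamma m adm.
have K_gt0 : 0 < K1 + K2.
  rewrite lt_neqAle addr_ge0 // andbT eq_sym paddr_eq0 //.
  by apply: contra K_neq0 => /andP[/eqP-> /eqP->]; rewrite expr0n addr0.
exists (s * (K1 + K2) * d) => [|x]; first by rewrite !mulr_gt0.
have := dA x; rewrite !qformNl qformZl qformDl !qformZl qform_tr => dAx.
by have := ler_wpM2l (ltW (mulr_gt0 s_gt0 K_gt0)) dAx; lra.
Qed.

End SchemeMatrices.

(** * Kronecker products *)

Section Kronecker.
Context {R : realType}.

Lemma mxn_ord {p} (A : 'M[R]_p) (i j : 'I_p) : mxn A i j = A i j.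
Proof. by rewrite /mxn !valK. Qed.

(** This gives access to the mixed-product rule [tensmx_mul]. *)
Lemma kronE {p q} (A : 'M[R]_p) (B : 'M[R]_q) : kron A B = (A *t B)%R.
Proof.
apply/matrixP => k l; rewrite !mxE.
by rewrite -(mxn_ord A) -(mxn_ord B).
Qed.

Lemma tens1mx1 {p q} : 1%:M *t 1%:M = 1%:M :> 'M[R]_(p * q).
Proof.
apply/matrixP => k l; case: (mxtens_indexP k) => i j; case: (mxtens_indexP l) => i' j'.
rewrite tensmxE !mxE -natrM mulnb (can_eq (@mxtens_indexK _ _)).
by rewrite xpair_eqE.
Qed.

Lemma tensmxDl {p q} (A B : 'M[R]_p) (C : 'M[R]_q) : (A + B) *t C = A *t C + B *t C.
Proof. by apply/matrixP => i j; rewrite !mxE mulrDl. Qed.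

Lemma tensmxDr {p q} (A : 'M[R]_p) (B C : 'M[R]_q) : A *t (B + C) = A *t B + A *t C.
Proof. by apply/matrixP => i j; rewrite !mxE mulrDr. Qed.

Lemma tensmxBl {p q} (A B : 'M[R]_p) (C : 'M[R]_q) : (A - B) *t C = A *t C - B *t C.
Proof. by apply/matrixP => i j; rewrite !mxE mulrBl. Qed.

Lemma tensmxBr {p q} (A : 'M[R]_p) (B C : 'M[R]_q) : A *t (B - C) = A *t B - A *t C.
Proof. by apply/matrixP => i j; rewrite !mxE mulrBr. Qed.

Lemma tensmxZl {p q} a (A : 'M[R]_p) (C : 'M[R]_q) : (a *: A) *t C = a *: (A *t C).
Proof. by apply/matrixP => i j; rewrite !mxE mulrA. Qed.

Lemma tensmxZr {p q} a (A : 'M[R]_p) (C : 'M[R]_q) : A *t (a *: C) = a *: (A *t C).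
Proof. by apply/matrixP => i j; rewrite !mxE mulrCA. Qed.

Lemma tensmxX {p q} (A : 'M[R]_p) (B : 'M[R]_q) n : (A *t B) ^+ n = (A ^+ n) *t (B ^+ n).
Proof.
elim: n => [|n IH]; first by rewrite !expr0 -!idmxE tens1mx1.
by rewrite !exprS IH -!mulmxE tensmx_mul.
Qed.

Lemma tens1mx_unit {p q} (B : 'M[R]_q) : B \in unitmx ->
  ((1%:M : 'M[R]_p) *t B \in unitmx) * (invmx ((1%:M : 'M[R]_p) *t B) = 1%:M *t invmx B).
Proof.
move=> Bu; have E : ((1%:M : 'M[R]_p) *t B) *m (1%:M *t invmx B) = 1%:M.
  by rewrite tensmx_mul mul1mx mulmxV // tens1mx1.
have [U _] := mulmx1_unit E; split=> //.
by rewrite -[RHS](mulKmx U) E mulmx1.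
Qed.

Lemma tensmx1_unit {p q} (A : 'M[R]_p) : A \in unitmx ->
  (A *t (1%:M : 'M[R]_q) \in unitmx) * (invmx (A *t (1%:M : 'M[R]_q)) = invmx A *t 1%:M).
Proof.
move=> Au; have E : (A *t (1%:M : 'M[R]_q)) *m (invmx A *t 1%:M) = 1%:M.
  by rewrite tensmx_mul mul1mx mulmxV // tens1mx1.
have [U _] := mulmx1_unit E; split=> //.
by rewrite -[RHS](mulKmx U) E mulmx1.
Qed.

End Kronecker.

Theorem theorem3 (R : realType) (pq : pq_choice) (alpha beta K1p K2p K1m K2m : R) :
  admissible pq alpha -> admissible pq beta ->
  0 <= K1p -> 0 <= K2p -> 0 <= K1m -> 0 <= K2m ->
  K1p ^+ 2 + K2p ^+ 2 != 0 -> K1m ^+ 2 + K2m ^+ 2 != 0 ->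
  uncond_stable pq alpha beta K1p K2p K1m K2m.
Proof.
move=> adma admb K1p0 K2p0 K1m0 K2m0 Kp Km tau h Nx Ny tau0 h0 _ _.
have s_gt0 g : 0 < tau / (2 * h `^ g) by rewrite divr_gt0 ?mulr_gt0 ?powR_gt0.
have Dco_x := coercive_diffusion pq alpha K1p K2p _ Nx adma K1p0 K2p0 Kp (s_gt0 alpha).
have Dco_y := coercive_diffusion pq beta K1m K2m _ Ny admb K1m0 K2m0 Km (s_gt0 beta).
have Cco_x := coercive_Cmat pq alpha Nx adma; have Cco_y := coercive_Cmat pq beta Ny admb.
have cvg_x := crank_nicolson_cvg0 _ _ (tr_Cmat pq alpha Nx) Cco_x Dco_x.
have cvg_y := crank_nicolson_cvg0 _ _ (tr_Cmat pq beta Ny) Cco_y Dco_y.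
have unit_x := coercive_unitmx _ (coerciveD _ _ Cco_x Dco_x).
have unit_y := coercive_unitmx _ (coerciveD _ _ Cco_y Dco_y).
(* The scalars move inside the products, so that each factor of [G] becomes [1 *t M] or [M *t 1]. *)
rewrite /Gmat /Cx /Cy /Dx /Dy !kronE -(tensmxZr _ 1%:M) -(tensmxZl _ _ 1%:M).
rewrite -!tensmxBl -!tensmxBr -!tensmxDl -!tensmxDr.
move: (tau / (2 * h `^ alpha) *: _) (tau / (2 * h `^ beta) *: _) => Dx Dy
  in cvg_x cvg_y unit_x unit_y *.
have [unit_y1 ->] := tensmx1_unit (q := Nx.-1) _ unit_y.
have [unit_1x ->] := tens1mx_unit (p := Ny.-1) _ unit_x.
(* The two [x]-factors are adjacent inside [G], so the mixed-product rule yields the tensor product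
   of the two one-dimensional iterations. *)
do 2!split=> //; rewrite !tensmx_mul !mulmx1 !mul1mx => k l.
case: (mxtens_indexP k) => i i'; case: (mxtens_indexP l) => j j'.
apply: cvg_trans (near_eq_cvg _) _; last first.
  rewrite -(mulr0 (0 : R)); exact: (cvgM (cvg_y i j) (cvg_x i' j')).
by near=> n; rewrite /= tensmxX tensmxE.
Unshelve. all: by end_near.
Qed.
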